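(* Let $n\ge 3m$, $|\Omega|=n$, $x\in\binom{\Omega}{m}$, and let $\mathcal{T}=\mathcal{T}(x)$ be the Terwilliger algebra of $J(n,m,m+1)$ with respect to $x$. For $0\le i,j\le 2m+1$ let $G_{i,j}=\{g: H^g_{m-\lfloor i/2\rfloor,\,m-\lfloor j/2\rfloor}(m)\neq 0\}$ and $R_{i,j}=\{r: H^r_{\lceil i/2\rceil,\,\lceil j/2\rceil}(n-m)\neq 0\}$. Then both $$\{L(H^g_{m-\lfloor i/2\rfloor,m-\lfloor j/2\rfloor}(m)\otimes H^r_{\lceil i/2\rceil,\lceil j/2\rceil}(n-m)) : g\in G_{i,j},\ r\in R_{i,j},\ 0\le i,j\le 2m+1\}$$ and $$\{L(C^l_{m-\lfloor i/2\rfloor,m-\lfloor j/2\rfloor}(m)\otimes C^s_{\lceil i/2\rceil,\lceil j/2\rceil}(n-m)) : l\in G_{i,j},\ s\in R_{i,j},\ 0\le i,j\le 2m+1\}$$ are bases of $\mathcal{T}$.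
   Context: $J(n,m,m+1)$ is the bipartite graph with vertex set $X=\binom{\Omega}{m}\cup\binom{\Omega}{m+1}$ ($\binom{S}{k}$ = set of $k$-subsets of $S$), $y\in\binom{\Omega}{m}$ adjacent to $z\in\binom{\Omega}{m+1}$ iff $y\subseteq z$; $A$ is its adjacency matrix. $\Gamma_k(x)$ is the set of vertices at distance $k$ from $x$; for $n\ge 2m+1$ the maximal distance from $x$ is $2m+1$, and $\Gamma_{2i}(x)=\{y\in\binom{\Omega}{m}:|x\cap y|=m-i\}$, $\Gamma_{2i+1}(x)=\{z\in\binom{\Omega}{m+1}:|x\cap z|=m-i\}$. $E^*_k$ is the diagonal $0/1$ matrix with $(y,y)$-entry $1$ iff $y\in\Gamma_k(x)$. The Terwilliger algebra $\mathcal{T}(x)$ is the subalgebra of $\mathrm{Mat}_X(\mathbb{C})$ generated by $A,E^*_0,\dots,E^*_{2m+1}$. A vertex $y\in\Gamma_k(x)$ is identified with $(y\cap x,y\setminus x)\in\binom{x}{m-\lfloor k/2\rfloor}\times\binom{\Omega\setminus x}{\lceil k/2\rceil}$, and $P\otimes Q$ is the Kronecker product with $(P\otimes Q)_{(\alpha,\beta),(\alpha',\beta')}=P_{\alpha\alpha'}Q_{\beta\beta'}$. For a set $V$ of size $v$: $C^l_{i,j}(v)$ is the matrix with rows indexed by $\binom{V}{i}$, columns by $\binom{V}{j}$ and $(y,z)$-entry $\binom{|y\cap z|}{l}$; $H^l_{i,j}(v)$ is the $(0,1)$-matrix with the same indexing and $(y,z)$-entry $1$ iff $|y\cap z|=l$.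 In the Kronecker products, $V=x$ ($v=m$) in the first factor and $V=\Omega\setminus x$ ($v=n-m$) in the second. For $M$ indexed by $\Gamma_i(x)\times\Gamma_j(x)$, $L(M)\in\mathrm{Mat}_X(\mathbb{C})$ has $\Gamma_i(x)\times\Gamma_j(x)$ block $M$ and all other blocks $0$. *)

(* Defs.v *)
From HB Require Import structures.
From mathcomp Require Import all_boot all_order all_algebra.
From mathcomp Require Export reals complex mxtens.

Set Implicit Arguments.
Unset Strict Implicit.
Unset Printing Implicit Defensive.

Import GRing.Theory.
Local Open Scope ring_scope.

Section Distance.
Variables (T : finType) (e : rel T).

Definition walk (k : nat) (x y : T) : bool :=
  [exists p : k.-tuple T, path e x p && (last x p == y)].

(* The graph distance from x to y is exactly k. *)
Definition at_dist (k : nat) (x y : T) : bool :=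
  walk k x y && [forall j : 'I_k, ~~ walk j x y].

Lemma walkP k x y :
  reflect (exists p, [/\ size p = k, path e x p & last x p = y]) (walk k x y).
Proof.
apply: (iffP existsP) => [[p /andP[pp /eqP lp]]|[p [/eqP sp pp lp]]].
  by exists p; rewrite size_tuple.
by exists (Tuple sp); rewrite /= pp lp eqxx.
Qed.

Lemma walkSr k x y :
  reflect (exists2 z, walk k x z & e z y) (walk k.+1 x y).
Proof.
apply: (iffP (walkP _ _ _)) => [[p []]|[z /walkP[p [sp pp lp]] ezy]].
  case/lastP: p => // p z; rewrite size_rcons rcons_path last_rcons.
  move=> [sp] /andP[pp ez] <-; exists (last x p) => //.
  by apply/walkP; exists p.
exists (rcons p y); rewrite size_rcons sp rcons_path last_rcons pp lp.
by split.
Qed.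

End Distance.

Section JohnsonGraph.
Variables (Omega : finType) (m : nat).

Definition ksub (V : {set Omega}) (k : nat) : finType :=
  {A : {set Omega} | (A \subset V) && (#|A| == k)}.

Definition vertex : finType :=
  {A : {set Omega} | (#|A| == m) || (#|A| == m.+1)}.

Definition adj : rel vertex := fun u v =>
  [&& #|val u| == m, #|val v| == m.+1 & val u \subset val v]
  || [&& #|val v| == m, #|val u| == m.+1 & val v \subset val u].

Variable x : ksub [set: Omega] m.

Fact base_subproof : (#|val x| == m) || (#|val x| == m.+1).
Proof. by case/andP: (valP x) => _ ->. Qed.

Definition base : vertex := Sub (val x) base_subproof.

Definition Gamma (k : nat) : {set vertex} := [set u | at_dist adj k base u].

Definition Gammat (k : nat) : finType := {u : vertex | u \in Gamma k}.

Lemma walk_base k u : walk adj k base u ->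
  #|val u| = (m + odd k)%N /\ (#|val x :\: val u| <= k./2)%N.
Proof.
have xm : #|val x| = m by case/andP: (valP x) => _ /eqP.
elim: k u => [|k IH] u.
  by case/walkP=> p [/size0nil -> _ /= <-] /=; rewrite setDv cards0 addn0.
case/walkSr=> v /IH[cv dv] /orP[] /and3P[/eqP c1 /eqP c2 sub].
  move: cv; rewrite c1 => /eqP; rewrite -{1}[m]addn0 eqn_add2l /= c2 => ok.
  rewrite uphalf_half; case: (odd k) ok => //= _; rewrite addn1; split=> //.
  exact: leq_trans (subset_leq_card (setDS _ sub)) dv.
move: cv; rewrite c2 => /eqP; rewrite -{1}addn1 eqn_add2l /= c1 uphalf_half.
case: (odd k) => //= _; rewrite addn0; split=> //.
have c3 : #|val v :\: val u| = 1%N.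
  by rewrite cardsD (setIidPr sub) c1 c2 subSnn.
suff le : (#|val x :\: val u| <= #|val x :\: val v| + #|val v :\: val u|)%N.
  by apply: leq_trans le _; rewrite c3 addn1 ltnS.
apply: leq_trans (leq_card_setU _ _); apply: subset_leq_card.
apply/subsetP=> a; rewrite !inE => /andP[-> ->] /=.
by rewrite andbT orNb.
Qed.

Lemma base_walk u :
  walk adj (#|val x :\: val u|.*2 + (#|val u| == m.+1)) base u.
Proof.
have xm : #|val x| = m by case/andP: (valP x) => _ /eqP.
move E: (_ + _)%N => k; elim: k u E => [|k IH] u.
  move/eqP; rewrite addn_eq0 double_eq0 cards_eq0 setD_eq0 eqb0.
  case/andP=> sub nu; have := valP u; rewrite (negbTE nu) orbF => /eqP um.
  apply/walkP; exists [::]; split=> //=; apply: val_inj => /=.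
  by apply/eqP; rewrite eqEcard sub um xm leqnn.
move=> E; apply/walkSr.
have := valP u; case: eqP => [um _|_ /= /eqP um].
  have [z zx] : exists z, z \in val x :\: val u.
    apply/set0Pn; apply/eqP=> d0.
    by move: E; rewrite d0 cards0 um ltn_eqF.
  move: (zx); rewrite inE => /andP[zu zX].
  have cv : #|z |: val u| = m.+1 by rewrite cardsU1 zu um.
  have vP : (#|z |: val u| == m) || (#|z |: val u| == m.+1).
    by rewrite cv eqxx orbT.
  exists (Sub (z |: val u) vP); last first.
    by apply/orP; right; rewrite /= cv um !eqxx subsetUr.
  apply: IH; rewrite /= cv eqxx; move: E; rewrite um ltn_eqF // addn0.
  rewrite (cardsD1 z) zx add1n doubleS addn1 => -[] <-; congr (_.*2.+1).
  by congr #|pred_of_set _|; rewrite setUC setDDl.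
have [z zu] : exists z, z \in val u :\: val x.
  apply/set0Pn; rewrite setD_eq0; apply/negP=> /subset_leq_card.
  by rewrite um xm ltnn.
move: (zu); rewrite inE => /andP[zX zU].
have cv : #|val u :\ z| = m by move: um; rewrite (cardsD1 z) zU => -[].
have vP : (#|val u :\ z| == m) || (#|val u :\ z| == m.+1) by rewrite cv eqxx.
exists (Sub (val u :\ z) vP); last first.
  by apply/orP; left; rewrite /= cv um !eqxx subD1set.
apply: IH; rewrite /= cv ltn_eqF // addn0.
move: E; rewrite um eqxx addn1 => -[] <-; congr (_.*2).
congr #|pred_of_set _|; apply/setP=> a; rewrite !inE negb_and negbK.
by case: eqP => // ->; rewrite (negbTE zX) !andbF.
Qed.

Lemma GammaP k u : u \in Gamma k ->
  #|val u :&: val x| = (m - k./2)%N /\ #|val u :\: val x| = uphalf k.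
Proof.
have xm : #|val x| = m by case/andP: (valP x) => _ /eqP.
rewrite inE => /andP[/walk_base[cu du] /forallP nw].
have dk : #|val x :\: val u| = k./2.
  apply/eqP; rewrite eqn_leq du leqNgt; apply/negP=> lt.
  have lt' : (#|val x :\: val u|.*2 + (#|val u| == m.+1) < k)%N.
    have -> : (#|val u| == m.+1) = odd k.
      by rewrite cu -addn1 eqn_add2l eqb1.
    by rewrite -[X in (_ < X)%N]odd_double_half addnC ltn_add2l ltn_double.
  by have := nw (Ordinal lt'); rewrite base_walk.
have e : (#|val u :&: val x| + k./2 = m)%N by rewrite -dk setIC cardsID xm.
have ci : #|val u :&: val x| = (m - k./2)%N by rewrite -[in RHS]e addnK.
split=> //; apply/eqP; rewrite -(eqn_add2l #|val u :&: val x|) cardsID cu.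
by rewrite uphalf_half addnCA e addnC.
Qed.

Fact coord1_subproof k (u : Gammat k) :
  (val (val u) :&: val x \subset val x)
  && (#|val (val u) :&: val x| == (m - k./2)%N).
Proof. by rewrite subsetIr; have [-> _] := GammaP (valP u); rewrite eqxx. Qed.

Fact coord2_subproof k (u : Gammat k) :
  (val (val u) :\: val x \subset ~: val x)
  && (#|val (val u) :\: val x| == uphalf k).
Proof.
by rewrite setDE subsetIr -setDE; have [_ ->] := GammaP (valP u); rewrite eqxx.
Qed.

Definition coord1 k (u : Gammat k) : ksub (val x) (m - k./2) :=
  Sub (val (val u) :&: val x) (coord1_subproof u).

Definition coord2 k (u : Gammat k) : ksub (~: val x) (uphalf k) :=
  Sub (val (val u) :\: val x) (coord2_subproof u).

End JohnsonGraph.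

(* Matrices with rows and columns indexed by finite types I and J are encoded *)
(* as 'M_(#|I|, #|J|), through enum_val and enum_rank.                        *)
Section Matrices.
Variables (K : fieldType) (Omega : finType).

Definition Cmx (l i j : nat) (V : {set Omega}) :
    'M[K]_(#|ksub V i|, #|ksub V j|) :=
  \matrix_(a, b) 'C(#|val (enum_val a) :&: val (enum_val b)|, l)%:R.

Definition Hmx (l i j : nat) (V : {set Omega}) :
    'M[K]_(#|ksub V i|, #|ksub V j|) :=
  \matrix_(a, b) (#|val (enum_val a) :&: val (enum_val b)| == l)%:R.

(* The bound #|V| loses nothing: see mem_Hsupp. *)
Definition Hsupp (i j : nat) (V : {set Omega}) : seq nat :=
  [seq l <- iota 0 #|V|.+1 | Hmx l i j V != 0].

Lemma mem_Hsupp i j V l : (l \in Hsupp i j V) = (Hmx l i j V != 0).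
Proof.
rewrite mem_filter mem_iota /= ltnS; case: (leqP l #|V|) => [|lt].
  by rewrite andbT.
rewrite andbF; apply/esym/negbF/eqP/matrixP=> a b; rewrite !mxE.
rewrite ltn_eqF //; apply: leq_ltn_trans lt; apply: subset_leq_card.
have /andP[sub _] := valP (enum_val a).
exact: subset_trans (subsetIl _ _) sub.
Qed.

Variable m : nat.

Definition Amx : 'M[K]_#|vertex Omega m| :=
  \matrix_(u, v) (adj (enum_val u) (enum_val v))%:R.

Variable x : ksub [set: Omega] m.

Definition Estar (k : nat) : 'M[K]_#|vertex Omega m| :=
  \matrix_(u, v) ((u == v) && (enum_val u \in Gamma x k))%:R.

Definition is_subalgebra N (S : {vspace 'M[K]_N}) : Prop :=
  1%:M \in S /\ {in S &, forall M1 M2, M1 *m M2 \in S}.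

(* M lies in the subalgebra generated by Amx and the Estar k, i.e. in every   *)
(* subalgebra containing them.                                                *)
Definition Terwilliger (M : 'M[K]_#|vertex Omega m|) : Prop :=
  forall S : {vspace 'M[K]_#|vertex Omega m|},
    is_subalgebra S -> Amx \in S ->
    (forall k, (k <= m.*2.+1)%N -> Estar k \in S) -> M \in S.

(* The index in the Kronecker product of the pair identified with u. *)
Definition kron_index k (u : Gammat x k) :
    'I_(#|ksub (val x) (m - k./2)| * #|ksub (~: val x) (uphalf k)|) :=
  mxtens_index (enum_rank (coord1 u), enum_rank (coord2 u)).

Definition kron i j
    (P : 'M[K]_(#|ksub (val x) (m - i./2)|, #|ksub (val x) (m - j./2)|))
    (Q : 'M[K]_(#|ksub (~: val x) (uphalf i)|, #|ksub (~: val x) (uphalf j)|)) :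
    'M[K]_(#|Gammat x i|, #|Gammat x j|) :=
  \matrix_(u, v)
    tensmx P Q (kron_index (enum_val u)) (kron_index (enum_val v)).

Definition Lmx i j (M : 'M[K]_(#|Gammat x i|, #|Gammat x j|)) :
    'M[K]_#|vertex Omega m| :=
  \matrix_(u, v)
    match insub (enum_val u) : option (Gammat x i),
          insub (enum_val v) : option (Gammat x j) with
    | Some u', Some v' => M (enum_rank u') (enum_rank v')
    | _, _ => 0
    end.

(* The family (F i j g r) for 0 <= i, j <= 2m+1, g in G_{i,j}, r in R_{i,j}. *)
Definition family_GR (F : nat -> nat -> nat -> nat -> 'M[K]_#|vertex Omega m|) :
    seq 'M[K]_#|vertex Omega m| :=
  flatten [seq [seq F i j g r | g <- Hsupp (m - i./2) (m - j./2) (val x),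
                                r <- Hsupp (uphalf i) (uphalf j) (~: val x)]
          | i <- iota 0 m.*2.+2, j <- iota 0 m.*2.+2].

Definition Hfamily : seq 'M[K]_#|vertex Omega m| :=
  family_GR (fun i j g r =>
    Lmx (kron (Hmx g (m - i./2) (m - j./2) (val x))
              (Hmx r (uphalf i) (uphalf j) (~: val x)))).

Definition Cfamily : seq 'M[K]_#|vertex Omega m| :=
  family_GR (fun i j l s =>
    Lmx (kron (Cmx l (m - i./2) (m - j./2) (val x))
              (Cmx s (uphalf i) (uphalf j) (~: val x)))).

End Matrices.

Arguments Terwilliger K {Omega m} x M.
Arguments Hfamily K {Omega m} x.
Arguments Cfamily K {Omega m} x.

(* basis_of, for a subspace of V given as a Prop-valued predicate. *)
Definition is_basis (K : fieldType) (V : vectType K) (P : V -> Prop)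
    (b : seq V) : Prop :=
  free b /\ (forall v, P v <-> v \in <<b>>%VS).

(* Main.v *)
(* Encode a vertex u by (|u :&: x|, |u :\: x|), which determines its distance
   to x, and a pair (u, v) by the codes of u, v and u :&: v. Two pairs have the
   same code iff some permutation of Omega fixing x maps one to the other, so
   the matrices that are constant on codes form an algebra. It contains A and
   the E*_k, and the nonzero indicator matrices X of the codes, which form the
   H-family, are a basis of it.

   Conversely, A moves between consecutive levels by adding or removing one
   point of x or of its complement. Walking one step and back multiplies X by
   a matrix acting tridiagonally on the index g = |u :&: v :&: x| (likewise on
   r), with nonzero lower coefficients (a - g)(a' - g), so all the X between
   two levels are generated by the one with the largest g and r. That one is,
   up to a nonzero scalar, a product of the blocks of A between the two levels.

   Finally C^l = sum_g binom(g, l) H^g is a unitriangular change of basis.    *)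
Require Import Defs.
From mathcomp Require Import all_boot all_order all_algebra.
From mathcomp Require Import perm zify.

Set Implicit Arguments.
Unset Strict Implicit.
Unset Printing Implicit Defensive.

Import GRing.Theory.

(** * Codes of sets and of pairs of sets relative to a fixed set [s] *)

Section Profile.
Variable Omega : finType.
Implicit Types s u v w : {set Omega}.

Definition pro s w := (#|w :&: s|, #|w :&: ~: s|).

Definition typ s u v := (pro s u, pro s v, pro s (u :&: v)).

Lemma proC s w : pro (~: s) w = (#|w :&: ~: s|, #|w :&: s|).
Proof. by rewrite /pro setCK. Qed.

Lemma pro_card s w : (pro s w).1 + (pro s w).2 = #|w|.
Proof. by rewrite /= -setDE cardsID. Qed.

(** A profile determines the cardinality, so nested sets with equal profiles coincide. This makes
    equality and inclusion readable from codes. *)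
Lemma pro_eq s u v : u \subset v -> (pro s u == pro s v) = (u == v).
Proof.
move=> suv; apply/eqP/eqP=> [e|-> //].
by apply/eqP; rewrite eqEcard suv -!(pro_card s) e leqnn.
Qed.

Lemma typE s u v p q o : (typ s u v == (p, q, o)) =
  [&& pro s u == p, pro s v == q & pro s (u :&: v) == o].
Proof. exact/esym/andbA. Qed.

Lemma typ_sym s u v u' v' :
  typ s u v = typ s u' v' -> typ s v u = typ s v' u'.
Proof.
by rewrite /typ /pro [v :&: u]setIC [v' :&: u']setIC => -[-> -> -> -> -> ->].
Qed.

Lemma typ_eq s u v u' v' :
  typ s u v = typ s u' v' -> (u == v) = (u' == v').
Proof.
move=> [a1 a2 b1 b2 c1 c2].
have E (y z : {set Omega}) : 
    (y == z) = (pro s y == pro s z) && (pro s (y :&: z) == pro s y).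
  apply/eqP/andP=> [->|[/eqP e]]; first by rewrite setIid.
  rewrite pro_eq ?subsetIl // => /eqP/setIidPl yz.
  by apply/eqP; rewrite -(pro_eq s) // e.
by rewrite E (E u') /pro a1 a2 b1 b2 c1 c2.
Qed.

Lemma typ_subset s u v u' v' :
  typ s u v = typ s u' v' -> (u \subset v) = (u' \subset v').
Proof.
move=> [a1 a2 b1 b2 c1 c2].
have E (y z : {set Omega}) : (y \subset z) = (pro s (y :&: z) == pro s y).
  by rewrite pro_eq ?subsetIl //; apply/setIidPl/eqP.
by rewrite E (E u') /pro a1 a2 c1 c2.
Qed.

Lemma pro_setD1 s u v y g r : y \in u :&: s ->
  (pro s ((u :\ y) :&: v) == (g, r)) =
  if y \in v then pro s (u :&: v) == (g.+1, r) else pro s (u :&: v) == (g, r).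
Proof.
rewrite inE => /andP[yu ys]; rewrite /pro.
have -> : (u :\ y) :&: v :&: ~: s = u :&: v :&: ~: s.
  by apply/setP=> z; rewrite !inE; case: eqP => // ->; rewrite ys !andbF.
have -> : (u :\ y) :&: v :&: s = (u :&: v :&: s) :\ y.
  by apply/setP=> z; rewrite !inE; case: eqP => // ->; rewrite !andbF.
rewrite [#|u :&: v :&: s|](cardsD1 y) !inE yu ys.
by case: (y \in v); rewrite /= ?andbF ?add1n ?add0n.
Qed.

(** Adding [y] raises the first coordinate exactly when [y] lies in [v]; writing the target as
    [g.+1] avoids a truncated predecessor. *)
Lemma pro_setU1 s u v y g r : y \in s :\: u ->
  (pro s ((y |: u) :&: v) == (g.+1, r)) =
  if y \in v then pro s (u :&: v) == (g, r) else pro s (u :&: v) == (g.+1, r).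
Proof.
rewrite inE => /andP[yu ys]; rewrite /pro.
have -> : (y |: u) :&: v :&: ~: s = u :&: v :&: ~: s.
  by apply/setP=> z; rewrite !inE; case: eqP => // ->; rewrite ys !andbF.
case: (boolP (y \in v)) => yv; last first.
  congr ((#|pred_of_set _|, _) == _).
  apply/setP=> z; rewrite !inE.
  by case: eqP => // ->; rewrite (negbTE yv) !andbF.
have -> : (y |: u) :&: v :&: s = y |: (u :&: v :&: s).
  by apply/setP=> z; rewrite !inE; case: eqP => // ->; rewrite yv ys.
by rewrite cardsU1 !inE (negbTE yu) add1n.
Qed.

End Profile.

(** * Matrices as functions of vertex pairs, and the action of [Amx] on code indicators *)

Section ClassMatrices.
Variables (K : fieldType) (Omega : finType) (m : nat).
Local Open Scope ring_scope.
Local Notation vertex := (vertex Omega m).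
Implicit Types (s : {set Omega}) (u v w : vertex).

Definition mxfun (f : vertex -> vertex -> K) : 'M[K]_#|vertex| :=
  \matrix_(p, q) f (enum_val p) (enum_val q).

Lemma eq_mxfun f g : f =2 g -> mxfun f = mxfun g.
Proof. by move=> fg; apply/matrixP=> p q; rewrite !mxE fg. Qed.

Lemma mxfun_mul f g :
  mxfun f *m mxfun g = mxfun (fun u v => \sum_w f u w * g w v).
Proof.
apply/matrixP=> p q; rewrite !mxE.
rewrite (big_enum_val (A := vertex)
  (fun w => f (enum_val p) w * g w (enum_val q))) /=.
by apply: eq_bigr => i _; rewrite !mxE.
Qed.

Lemma mxfunD f g : mxfun f + mxfun g = mxfun (fun u v => f u v + g u v).
Proof. by apply/matrixP=> p q; rewrite !mxE. Qed.

Lemma mxfunZ a f : a *: mxfun f = mxfun (fun u v => a * f u v).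
Proof. by apply/matrixP=> p q; rewrite !mxE. Qed.

Lemma mxfun_tr f : (mxfun f)^T = mxfun (fun u v => f v u).
Proof. by apply/matrixP=> p q; rewrite !mxE. Qed.

Lemma mxfun_surj (M : 'M[K]_#|vertex|) :
  M = mxfun (fun u v => M (enum_rank u) (enum_rank v)).
Proof. by apply/matrixP=> p q; rewrite !mxE !enum_valK. Qed.

(** Every [t] is allowed: a code attained by no pair gives the zero matrix. *)
Definition Xmx s t := mxfun (fun u v => (typ s (val u) (val v) == t)%:R).

Definition Emx s p := mxfun (fun u v => ((u == v) && (pro s (val u) == p))%:R).

Lemma Amx_mxfun : Amx K Omega m = mxfun (fun u v => (adj u v)%:R).
Proof. by []. Qed.

(** Lets results on the part inside [s] be transferred to the part outside. *)
Lemma Xmx_compl s a b c d e f :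
  Xmx (~: s) ((b, a), (d, c), (f, e)) = Xmx s ((a, b), (c, d), (e, f)).
Proof.
apply: eq_mxfun => u v; rewrite /typ !proC /pro; congr (nat_of_bool _)%:R.
by apply/eqP/eqP=> -[-> -> -> -> -> ->].
Qed.

Lemma Emx_compl s a b : Emx (~: s) (b, a) = Emx s (a, b).
Proof.
by apply: eq_mxfun => u v; rewrite !proC /pro !xpair_eqE [(_ == b) && _]andbC.
Qed.

Lemma Xmx_tr s p q o : (Xmx s (p, q, o))^T = Xmx s (q, p, o).
Proof.
rewrite /Xmx mxfun_tr; apply: eq_mxfun => u v.
by rewrite !typE [val v :&: _]setIC andbCA.
Qed.

Lemma Emx_tr s p : (Emx s p)^T = Emx s p.
Proof.
rewrite mxfun_tr; apply: eq_mxfun => u v; rewrite eq_sym.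
by case: eqP => // ->.
Qed.

Lemma adj_sym u v : adj u v = adj v u.
Proof. exact: orbC. Qed.

Lemma Amx_tr : (Amx K Omega m)^T = Amx K Omega m.
Proof.
by rewrite Amx_mxfun mxfun_tr; apply: eq_mxfun => u v; rewrite adj_sym.
Qed.

(** If [u], [v] and their intersection share one profile, both inclusions of the intersection are
    equalities, whence [u = v]. *)
Lemma Emx_Xmx s p : Emx s p = Xmx s (p, p, p).
Proof.
apply: eq_mxfun => u v; congr (nat_of_bool _)%:R.
apply/idP/eqP => [/andP[/eqP-> /eqP <-]|]; first by rewrite /typ setIid.
case: p => a b [a1 a2 b1 b2 c1 c2].
have E : pro s (val u) = (a, b) by rewrite /pro a1 a2.
rewrite E eqxx andbT -val_eqE; apply/eqP; transitivity (val u :&: val v).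
  by apply/eqP; rewrite eq_sym -(pro_eq s) ?subsetIl // E /pro c1 c2.
by apply/eqP; rewrite -(pro_eq s) ?subsetIr // /pro b1 b2 c1 c2.
Qed.

Lemma EAmxfun s p f : Emx s p *m Amx K Omega m *m mxfun f =
  mxfun (fun u v => (pro s (val u) == p)%:R * \sum_(w | adj u w) f w v).
Proof.
rewrite Amx_mxfun !mxfun_mul; apply: eq_mxfun => u v.
rewrite mulr_sumr [RHS]big_mkcond /=; apply: eq_bigr => w _.
rewrite (bigD1 u) //= big1 ?addr0 => [|z /negbTE zu]; last first.
  by rewrite eq_sym zu mul0r.
by rewrite eqxx /=; case: (adj u w); rewrite ?mulr1 // mulr0 mul0r.
Qed.

(** The neighbours of [u] with profile [(a, b)] are the sets [u :\ y] with [y] in [u :&: s], each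
    obtained once. *)
Lemma sum_nbr_rem s u a b (F : {set Omega} -> K) :
  (a + b = m)%N -> pro s (val u) = (a.+1, b) ->
  \sum_(w | adj u w && (pro s (val w) == (a, b))) F (val w) =
  \sum_(y in val u :&: s) F (val u :\ y).
Proof.
(* The default [u] of [insubd] is never returned for [y] in [u :&: s], since removing [y] leaves [m]
   points. *)
move=> abm pu; pose h y := insubd u (val u :\ y).
have cu : #|val u| = m.+1 by rewrite -(pro_card s) pu /= addSn abm.
have cu1 y : y \in val u -> #|val u :\ y| = m.
  by move=> yu; move: cu; rewrite (cardsD1 y) yu => -[].
have vh y : y \in val u :&: s -> val (h y) = val u :\ y.
  rewrite inE => /andP[yu ys]; rewrite val_insubd.
  by rewrite cu1 // eqxx.
have hin : {in val u :&: s &, injective h}.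
  move=> y z yu zu /(congr1 val); rewrite !vh // => /setP/(_ y).
  rewrite !inE eqxx /=; move: yu; rewrite inE => /andP[-> _].
  by rewrite andbT; case: eqP.
transitivity (\sum_(w in [set h y | y in val u :&: s]) F (val w)); last first.
  by rewrite big_imset //=; apply: eq_bigr => y yu; rewrite vh.
apply: eq_bigl => w; apply/andP/imsetP => [[uw /eqP pw]|[y yu ->]].
  have cw : #|val w| = m by rewrite -(pro_card s) pw.
  move: uw; rewrite /adj cw cu !eqxx eqn_leq ltnn /= => swu.
  have [y /setP yE] : exists y, val u :\: val w = [set y].
    by apply/cards1P; rewrite cardsD (setIidPr swu) cu cw subSnn.
  have uE : val w = val u :\ y.
    apply/setP=> z; move: (yE z); rewrite !inE => <-.
    rewrite negb_and negbK.
    case: (boolP (z \in val w)) => [/(subsetP swu) -> //|_].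
    by case: (z \in val u).
  have yu : y \in val u by have := yE y; rewrite !inE eqxx => /andP[].
  have ys : y \in s.
    (* Removing a point outside [s] would keep the first coordinate, which has to drop from [a.+1]
       to [a]. *)
    apply/negPn/negP=> ys; have := congr1 fst pw; have := congr1 fst pu.
    rewrite /= uE.
    have -> : (val u :\ y) :&: s = val u :&: s; last by move=> ->; lia.
    apply/setP=> z; rewrite !inE.
    by case: eqP => // ->; rewrite (negbTE ys) !andbF.
  have yus : y \in val u :&: s by rewrite inE yu.
  by exists y => //; apply: val_inj; rewrite vh.
split; last first.
  (* Intersecting with [setT] gives the profile of [u :\ y] itself. *)
  by have := pro_setD1 setT a b yu; rewrite !setIT in_setT pu eqxx vh.
rewrite /adj vh // cu; move: yu; rewrite inE => /andP[yu _].
by rewrite cu1 // !eqxx subD1set orbT.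
Qed.

Lemma sum_nbr_add s u a b (F : {set Omega} -> K) :
  (a + b = m)%N -> pro s (val u) = (a, b) ->
  \sum_(w | adj u w && (pro s (val w) == (a.+1, b))) F (val w) =
  \sum_(y in s :\: val u) F (y |: val u).
Proof.
move=> abm pu; pose h y := insubd u (y |: val u).
have cu : #|val u| = m by rewrite -(pro_card s) pu.
have vh y : y \in s :\: val u -> val (h y) = y |: val u.
  rewrite inE => /andP[yu ys]; rewrite val_insubd cardsU1 yu cu.
  by rewrite add1n eqxx orbT.
have hin : {in s :\: val u &, injective h}.
  move=> y z yu zu /(congr1 val); rewrite !vh // => /setP/(_ y).
  rewrite !inE eqxx /=; move: yu; rewrite inE => /andP[/negbTE -> _].
  by rewrite orbF; case: eqP.
transitivity (\sum_(w in [set h y | y in s :\: val u]) F (val w)); last first.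
  by rewrite big_imset //=; apply: eq_bigr => y yu; rewrite vh.
apply: eq_bigl => w; apply/andP/imsetP => [[uw /eqP pw]|[y yu ->]].
  have cw : #|val w| = m.+1 by rewrite -(pro_card s) pw /= addSn abm.
  move: uw; rewrite /adj cw cu !eqxx (gtn_eqF (ltnSn m)) /= orbF => suw.
  have [y /setP yE] : exists y, val w :\: val u = [set y].
    by apply/cards1P; rewrite cardsD (setIidPr suw) cu cw subSnn.
  have uE : val w = y |: val u.
    apply/setP=> z; move: (yE z); rewrite !inE => <-.
    case: (boolP (z \in val u)) => [/(subsetP suw) ->|_] /=;
    by rewrite ?orbF ?orbT.
  have yu : y \notin val u by have := yE y; rewrite !inE eqxx => /andP[].
  have ys : y \in s.
    apply/negPn/negP=> ys; have := congr1 fst pw; have := congr1 fst pu.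
    rewrite /= uE.
    have -> : (y |: val u) :&: s = val u :&: s; last by move=> ->; lia.
    apply/setP=> z; rewrite !inE.
    by case: eqP => // ->; rewrite (negbTE ys) !andbF.
  have yus : y \in s :\: val u by rewrite inE yu.
  by exists y => //; apply: val_inj; rewrite vh.
split; last first.
  by have := pro_setU1 setT a b yu; rewrite !setIT in_setT pu eqxx vh.
rewrite /adj vh //; move: yu; rewrite inE => /andP[yu _].
by rewrite cardsU1 yu cu !eqxx subsetUr.
Qed.

Lemma sum_split_setI (S v : {set Omega}) (b c : bool) :
  \sum_(y in S) ((if y \in v then b else c)%:R : K) =
  b%:R *+ #|S :&: v| + c%:R *+ #|S :\: v|.
Proof.
rewrite (big_setID v) /=; congr (_ + _).
  rewrite -[RHS]sumr_const; apply: eq_bigr => y.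
  by rewrite inE => /andP[_ ->].
rewrite -[RHS]sumr_const; apply: eq_bigr => y.
by rewrite inE => /andP[/negbTE-> _].
Qed.

(** The neighbour is [u :\ y]. Either [y] lies in [v], with [g.+1] choices and an index dropping
    from [g.+1] to [g], or it does not, with [a.+1 - g] choices and the index kept. *)
Lemma Xmx_add s a b q g r : (a + b = m)%N ->
  Emx s (a.+1, b) *m Amx K Omega m *m Xmx s ((a, b), q, (g, r)) =
  g.+1%:R *: Xmx s ((a.+1, b), q, (g.+1, r)) +
  (a.+1 - g)%:R *: Xmx s ((a.+1, b), q, (g, r)).
Proof.
move=> abm; rewrite EAmxfun !mxfunZ mxfunD; apply: eq_mxfun => u v.
rewrite !typE; case: (eqVneq (pro s (val u)) (a.+1, b)) => pu; last first.
  by rewrite mul0r !mulr0 addr0.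
case: (eqVneq (pro s (val v)) q) => pv; last first.
  rewrite /= !mulr0 addr0.
  by rewrite big1 ?mulr0 // => w _; rewrite typE (negbTE pv) !andbF.
rewrite mul1r /=.
pose F (w : {set Omega}) : K := (pro s (w :&: val v) == (g, r))%:R.
transitivity (\sum_(w | adj u w && (pro s (val w) == (a, b))) F (val w)).
  rewrite [RHS]big_mkcondr; apply: eq_bigr => w _ /=.
  by rewrite /F typE pv eqxx; case: ifP.
rewrite sum_nbr_rem //.
rewrite (eq_bigr (fun y => (if y \in val v
    then pro s (val u :&: val v) == (g.+1, r)
    else pro s (val u :&: val v) == (g, r))%:R)); last first.
  by move=> y yu; rewrite /F pro_setD1.
rewrite sum_split_setI; congr (_ + _).
  rewrite -mulr_natl; case: eqP => [[<- _]|_]; last by rewrite !mulr0.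
  by rewrite setIAC.
rewrite -mulr_natl; case: eqP => [[<- _]|_]; last by rewrite !mulr0.
by rewrite cardsD [val u :&: s :&: _]setIAC; case: pu => ->.
Qed.

(** Dual count: the neighbour is [y |: u] with [y] in [s :\: u]. The points of [v] there number [a']
    minus the index of [u :&: v], and the other points make up the rest of [#|s| - a]. *)
Lemma Xmx_rem s a b a' b' g r : (a + b = m)%N ->
  Emx s (a, b) *m Amx K Omega m *m Xmx s ((a.+1, b), (a', b'), (g.+1, r)) =
  (#|s| - a - (a' - g.+1))%:R *: Xmx s ((a, b), (a', b'), (g.+1, r)) +
  (a' - g)%:R *: Xmx s ((a, b), (a', b'), (g, r)).
Proof.
move=> abm; rewrite EAmxfun !mxfunZ mxfunD; apply: eq_mxfun => u v.
rewrite !typE; case: (eqVneq (pro s (val u)) (a, b)) => pu; last first.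
  by rewrite mul0r !mulr0 addr0.
case: (eqVneq (pro s (val v)) (a', b')) => pv; last first.
  rewrite /= !mulr0 addr0.
  by rewrite big1 ?mulr0 // => w _; rewrite typE (negbTE pv) !andbF.
rewrite mul1r /=.
pose F (w : {set Omega}) : K := (pro s (w :&: val v) == (g.+1, r))%:R.
transitivity (\sum_(w | adj u w && (pro s (val w) == (a.+1, b))) F (val w)).
  rewrite [RHS]big_mkcondr; apply: eq_bigr => w _ /=.
  by rewrite /F typE pv eqxx; case: ifP.
rewrite sum_nbr_add //.
rewrite (eq_bigr (fun y => (if y \in val v
    then pro s (val u :&: val v) == (g, r)
    else pro s (val u :&: val v) == (g.+1, r))%:R)); last first.
  by move=> y yu; rewrite /F pro_setU1.
have e1 : #|(s :\: val u) :&: val v| = (a' - #|val u :&: val v :&: s|)%N.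
  case: pv => <- _; rewrite setIDAC [s :&: _]setIC cardsD; congr (_ - _)%N.
  by rewrite [_ :&: val u]setIC setIA.
rewrite sum_split_setI addrC; congr (_ + _); rewrite -mulr_natl.
  case: eqP => [[e _]|_]; last by rewrite !mulr0.
  congr (_%:R * _); rewrite cardsD e1 e; congr (_ - _)%N.
  by rewrite cardsD [s :&: _]setIC; case: pu => ->.
by case: eqP => [[e _]|_]; rewrite ?mulr0 // e1 e.
Qed.

End ClassMatrices.

(** * Generating the code indicators from [Amx] and the matrices [Emx] *)

Section Generation.
Variables (K : fieldType) (Omega : finType) (m : nat).
(** Characteristic zero: nonzero counting coefficients must be invertible. *)
Hypothesis natK_eq0 : forall n, ((n%:R : K) == 0)%R = (n == 0).
Local Open Scope ring_scope.
Local Notation mat := 'M[K]_#|vertex Omega m|.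
Variable P : mat -> Prop.
Hypothesis P_lin : forall c M N, P M -> P N -> P (c *: M + N).
Hypothesis P_mul : forall M N, P M -> P N -> P (M *m N).
Hypothesis P_tr : forall M, P M -> P M^T.
Hypothesis P0 : P 0.
Hypothesis PA : P (Amx K Omega m).
Local Notation X := (Xmx K m).
Local Notation E := (Emx K m).
Implicit Types s : {set Omega}.

Lemma Xmx_eq0 s a b a' b' g r : (minn a a' < g)%N ->
  X s ((a, b), (a', b'), (g, r)) = 0.
Proof.
move=> lg; apply/matrixP=> p q; rewrite !mxE; case: eqP => // -[e1 _ e2 _ e3 _].
move: lg; rewrite ltnNge leq_min -e1 -e2 -e3 !subset_leq_card //.
  by rewrite setSI ?subsetIr.
by rewrite setSI ?subsetIl.
Qed.

Lemma P_cancel (n : nat) M N : n != 0%N -> P N -> P (n%:R *: M + N) -> P M.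
Proof.
move=> n0 PN PMN; have nK : (n%:R : K) != 0 by rewrite natK_eq0.
have -> : M = n%:R^-1 *: (-1 *: N + (n%:R *: M + N)) + 0.
  by rewrite scaleN1r addrCA addNr !addr0 scalerA mulVf ?scale1r.
by apply/P_lin/P0/P_lin.
Qed.

Lemma P_scale c M : P M -> P (c *: M).
Proof. by move=> PM; rewrite -[_ *: _]addr0; apply: P_lin. Qed.

Lemma P_add M N : P M -> P N -> P (M + N).
Proof. by move=> PM PN; rewrite -[M]scale1r; apply: P_lin. Qed.

(* Walking to the adjacent level that differs in the s-part and back produces *)
(* the index g with the nonzero coefficient (a - g) * (a' - g).               *)
Lemma P_descend s (PE : forall p, P (E s p)) a b a' b' r g :
    (a + b == m)%N || (a + b == m.+1)%N -> (g < minn a a')%N ->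
    P (X s ((a, b), (a', b'), (g.+1, r))) ->
    P (X s ((a, b), (a', b'), (g.+2, r))) ->
  P (X s ((a, b), (a', b'), (g, r))).
Proof.
move=> abm; rewrite leq_min => /andP[ga ga'] P1 P2.
have c0 : ((a - g) * (a' - g))%N != 0%N.
  by rewrite muln_eq0 negb_or !subn_eq0 -!ltnNge ga ga'.
(* If [u] has [m] points, the walk first visits profile [(a.+1, b)] and then returns. *)
case/orP: abm => [/eqP abm|].
  have := P_mul (PE (a.+1, b)) PA => /P_mul/(_ P1).
  have := P_mul (PE (a, b)) PA => /P_mul/[apply].
  rewrite Xmx_add // mulmxDr -!scalemxAr !Xmx_rem // !scalerDr !scalerA.
  rewrite [_ + (_ *: _ + _)]addrC -addrA [_ *: _ + (_ + _)]addrCA -natrM subSS.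
  by apply: (P_cancel c0); do !apply: P_add; apply: P_scale.
(* If [u] has [m.+1] points, the walk first loses a point of [s]; this is possible because [g < a]
   makes [a] positive. *)
case: a ga c0 P1 P2 => // a ga c0 P1 P2.
rewrite addSn eqSS => /eqP abm.
have := P_mul (PE (a, b)) PA => /P_mul/(_ P1).
have := P_mul (PE (a.+1, b)) PA => /P_mul/[apply].
rewrite Xmx_rem // mulmxDr -!scalemxAr !Xmx_add // !scalerDr !scalerA.
rewrite [_ + (_ *: _ + _)]addrC -addrA [_ *: _ + (_ + _)]addrCA -natrM.
rewrite [((a' - g) * _)%N]mulnC.
by apply: (P_cancel c0); do !apply: P_add; apply: P_scale.
Qed.

(** Downward induction on [g]. Each descent needs the indices [g.+1] and [g.+2]; those above the
    minimum give zero matrices, so the top index alone starts the recursion. *)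
Lemma P_from_top s (PE : forall p, P (E s p)) a b a' b' r g :
    (a + b == m)%N || (a + b == m.+1)%N ->
    P (X s ((a, b), (a', b'), (minn a a', r))) ->
  P (X s ((a, b), (a', b'), (g, r))).
Proof.
move=> abm Ptop; have: (minn a a' <= g + minn a a')%N by apply: leq_addl.
move: {2}(minn a a') => d; elim: d g => [|d IH] g.
  rewrite addn0 leq_eqVlt => /orP[/eqP <- //|lt].
  by rewrite Xmx_eq0.
move=> le; case: (leqP (minn a a') (g + d)) => [/IH //|lt].
have lt' : (g < minn a a')%N by apply: leq_ltn_trans lt; apply: leq_addr.
by apply: (P_descend PE abm lt'); apply: IH; lia.
Qed.

Variable x : {set Omega}.
Hypothesis PE : forall p, P (E x p).

(** The common profile, relative to the base vertex, of the vertices at distance [k] from it. *)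
Definition level k := (m - k./2, uphalf k)%N.

Lemma level_card k : (k <= m.*2.+1)%N ->
  ((level k).1 + (level k).2 = m + odd k)%N.
Proof. by rewrite /level /= uphalf_half; lia. Qed.

(** Going one level further adds a point outside the base set when [k] is even, and by the next
    lemma removes a point of it when [k] is odd. *)
Lemma levelS_even k : ~~ odd k -> level k.+1 = ((level k).1, (level k).2.+1).
Proof. by move=> ok; rewrite /level /= uphalfE /= uphalf_half (negbTE ok). Qed.

Lemma levelS_odd k : (k < m.*2.+1)%N -> odd k ->
  level k = ((level k.+1).1.+1, (level k.+1).2).
Proof. by move=> lk ok; rewrite /level /=; congr (_, _); lia. Qed.

Lemma PEC p : P (E (~: x) p).
Proof. by case: p => b a; rewrite Emx_compl. Qed.

(** Induction on [i - j] from the diagonal matrix [E x (level j)]. Multiplying by the next block of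
    [Amx] gives two terms, one of which vanishes because its index exceeds the minimum; the other is
    a nonzero multiple of the next top matrix. *)
Lemma P_top i j : (j <= i <= m.*2.+1)%N ->
  P (X x (level i, level j, (minn (level i).1 (level j).1,
                             minn (level i).2 (level j).2))).
Proof.
case/andP=> /subnK <-; elim: (i - j)%N => [|d IH] le.
  have := PE (level j); rewrite Emx_Xmx !minnn.
  by rewrite -surjective_pairing.
have {IH} := IH (ltnW le); move: le; rewrite addSn; set k := (d + j)%N => le.
have jk : (j <= k)%N by apply: leq_addl.
have ck := level_card (ltnW le); have ck1 := level_card le.
have mono : ((level k.+1).1 <= (level k).1 <= (level j).1)%N
  /\ ((level j).2 <= (level k).2 <= (level k.+1).2)%N.
  by rewrite /level /=; lia.
case: mono => /andP[l1 l2] /andP[l3 l4].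
rewrite (minn_idPl l2) (minn_idPr l3) (minn_idPl (leq_trans l1 l2)).
rewrite (minn_idPr (leq_trans l3 l4)).
case: (boolP (odd k)) => ok.
  have lk := levelS_odd le ok.
  move: ck1 l1 l2 l3; rewrite lk [odd k.+1]/= ok addn0.
  case: (level k.+1) => a b; case: (level j) => a' b' /= abm l1 l2 l3 PX.
  (* The vanishing term has index [a.+1], too large for a row profile [(a, b)]; the remaining
     coefficient is [a' - a], nonzero since [a < a']. *)
  have := P_mul (PE (a, b)) PA => /P_mul/(_ PX).
     rewrite Xmx_rem // [X in _ *: X + _]Xmx_eq0 ?scaler0 ?add0r; last first.
    by rewrite gtn_min leqnn.
  rewrite -[_ *: _]addr0; apply: P_cancel P0.
  by rewrite subn_eq0 -ltnNge.
have lk := levelS_even ok.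
move: ck l1 l2 l3; rewrite lk (negbTE ok) addn0.
case: (level k) => a b; case: (level j) => a' b' /= abm l1 l2 l3.
(* The step adds a point outside [x], so the computation is done relative to [~: x]. The surviving
   coefficient is [b.+1 - b']. *)
rewrite -!(Xmx_compl K m x) => PX.
have := P_mul (PEC (b.+1, a)) PA => /P_mul/(_ PX).
rewrite Xmx_add 1?addnC // [X in _ *: X + _]Xmx_eq0 ?scaler0 ?add0r; last first.
  by rewrite gtn_min leqnn orbT.
rewrite -[_ *: _]addr0; apply: P_cancel P0.
by rewrite subn_eq0 -ltnNge ltnS.
Qed.

(** From the top matrix, descend first in the outer index, relative to [~: x], and then in the inner
    one. *)
Lemma P_Xmx_le i j g r : (j <= i <= m.*2.+1)%N ->
  P (X x (level i, level j, (g, r))).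
Proof.
move=> ij; have := P_top ij; case/andP: ij => _ /level_card.
case: (level i) => a b; case: (level j) => a' b' /= abm.
have abm' : (a + b == m)%N || (a + b == m.+1)%N.
  by rewrite abm; case: odd; rewrite ?addn0 ?addn1 eqxx ?orbT.
have bam : (b + a == m)%N || (b + a == m.+1)%N by rewrite addnC.
rewrite -Xmx_compl => /(P_from_top PEC r bam); rewrite Xmx_compl.
exact: P_from_top.
Qed.

Lemma P_Xmx i j g r : (i <= m.*2.+1)%N -> (j <= m.*2.+1)%N ->
  P (X x (level i, level j, (g, r))).
Proof.
move=> i2 j2; case/orP: (leq_total j i) => ij.
  by apply: P_Xmx_le; rewrite ij.
by rewrite -Xmx_tr; apply/P_tr/P_Xmx_le; rewrite ij.
Qed.

End Generation.

(** * Codes as orbits of the permutations that fix [s] *)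

(** The lists of colours given by [c] and [c'] are rearrangements of each other, and the permutation
    of indices between them is the required map. *)
Lemma eq_card_fibers_inj (T : finType) (C : eqType) (c c' : T -> C) :
    (forall k, #|[pred z | c z == k]| = #|[pred z | c' z == k]|) ->
  exists2 f : T -> T, injective f & forall z, c' (f z) = c z.
Proof.
move=> cc'; have : perm_eq (codom_tuple c) (codom_tuple c').
  have cnt (b : T -> C) k : count_mem k (codom b) = #|[pred z | b z == k]|.
    by rewrite count_map cardE size_filter enumT; apply: eq_count.
  by apply/allP=> k _ /=; rewrite !cnt cc'.
case/tuple_permP=> p cp; exists (fun z => enum_val (p (enum_rank z))).
  by move=> y z /enum_val_inj/perm_inj/enum_rank_inj.
move=> z; have : tnth (codom_tuple c) (enum_rank z) =
    tnth (codom_tuple c') (p (enum_rank z)).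
  rewrite -[RHS](tnth_mktuple (fun i => tnth (codom_tuple c') (p i))).
  by congr tnth; apply: val_inj.
by rewrite !(tnth_nth (c z)) !nth_codom enum_rankK.
Qed.

Section Orbits.
Variable Omega : finType.
Implicit Types s u v w : {set Omega}.

(** Each point is coloured by its membership in [s], [u] and [v]; equal codes give colour classes of
    equal sizes. *)
Lemma typ_orbit s u v u' v' : typ s u v = typ s u' v' ->
  exists2 f : Omega -> Omega, injective f &
    [/\ f @^-1: s = s, f @^-1: u' = u & f @^-1: v' = v].
Proof.
pose col (y z : {set Omega}) a := (a \in s, a \in y, a \in z).
move=> e; have [|f fI fE] := @eq_card_fibers_inj _ _ (col u v) (col u' v').
  case=> -[b1 b2] b3; pose t := if b1 then s else ~: s.
  (* Inclusion-exclusion expresses the size of each of the eight cells through the code and the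
     sizes of [s] and its complement. *)
  have cell y z : #|[pred a | col y z a == (b1, b2, b3)]| =
      (if b2 then if b3 then #|y :&: z :&: t| else #|y :&: t| - #|y :&: z :&: t|
       else if b3 then #|z :&: t| - #|y :&: z :&: t|
       else #|t| - #|y :&: t| - (#|z :&: t| - #|y :&: z :&: t|))%N.
    pose part (w A : {set Omega}) b := if b then A :&: w else A :\: w.
    transitivity #|part z (part y t b2) b3|.
      apply: eq_card => a; rewrite !inE /col /part /t !xpair_eqE.
      case: b1 {t}; case: b2; case: b3; rewrite !inE;
      by case: (a \in s); case: (a \in y); case: (a \in z).
    have yzt : y :&: z :&: t = t :&: y :&: z by rewrite setIC setIA.
    rewrite /part yzt ![_ :&: t]setIC; case: b2; case: b3; rewrite ?cardsD //.
      by rewrite setIDAC cardsD setIAC.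
    by rewrite setIDAC cardsD setIAC.
  rewrite !cell /t; case: e => a1 a2 c1 c2 d1 d2.
  by case: (b1); rewrite ?a1 ?a2 ?c1 ?c2 ?d1 ?d2.
exists f => //; split; apply/setP=> a; rewrite inE; have [e1 e2 e3] := fE a.
- by [].
- by [].
- by [].
Qed.

Lemma typ_preimset (f : Omega -> Omega) s u v : injective f ->
  f @^-1: s = s -> typ s (f @^-1: u) (f @^-1: v) = typ s u v.
Proof.
move=> fI fs; have fp w : pro s (f @^-1: w) = pro s w.
  by rewrite /pro -{1 2}fs -preimsetC -!preimsetI !card_preimset.
by rewrite /typ -preimsetI !fp.
Qed.

End Orbits.

(** * Matrices that are constant on codes *)

Section Classes.
Variables (K : fieldType) (Omega : finType) (m : nat).
Local Open Scope ring_scope.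
Local Notation vertex := (vertex Omega m).
Variable s : {set Omega}.
Implicit Types u v w : vertex.

Definition typ_invariant (f : vertex -> vertex -> K) := forall u v u' v',
  typ s (val u) (val v) = typ s (val u') (val v') -> f u v = f u' v'.

(** A permutation carrying one pair to the other reindexes the intermediate vertex [w] without
    changing the codes of the two factors. *)
Lemma typ_invariant_mul f g : typ_invariant f -> typ_invariant g ->
  typ_invariant (fun u v => \sum_w f u w * g w v).
Proof.
move=> fi gi u v u' v' /typ_orbit[h hI [hs hu hv]].
pose act w := insubd w (h @^-1: val w).
have actE w : val (act w) = h @^-1: val w.
  by rewrite val_insubd card_preimset // (valP w).
have act_inj : injective act.
  move=> y z /(congr1 val); rewrite !actE => yz; apply: val_inj => /=.
  apply/setP=> a; have [h' _ h'K] := injF_bij hI.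
  by move/setP/(_ (h' a)): yz; rewrite !inE h'K.
rewrite (reindex_inj act_inj) /=; apply: eq_bigr => w _.
congr (_ * _); [apply: fi | apply: gi]; rewrite actE.
  by rewrite -hu typ_preimset.
by rewrite -hv typ_preimset.
Qed.

Lemma typ_invariant_span f (U : {vspace 'M[K]_#|vertex|}) :
  typ_invariant f -> (forall t, Xmx K m s t \in U) -> mxfun f \in U.
Proof.
move=> fi XU; pose ty (p : vertex * vertex) := typ s (val p.1) (val p.2).
(* The value of [f] at an arbitrary pair of code [t]. The sum runs over attained codes only, so the
   default 0 is never taken. *)
pose c t := if [pick p | ty p == t] is Some p then f p.1 p.2 else 0.
suff -> : mxfun f = \sum_(t <- undup (codom ty)) c t *: Xmx K m s t.
  by apply: memv_suml => t _; apply: memvZ.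
apply/matrixP=> p q; rewrite summxE mxE.
set u := enum_val p; set v := enum_val q.
rewrite (bigD1_seq (ty (u, v))) ?undup_uniq ?mem_undup ?codom_f //=.
rewrite big1 => [|t]; last first.
  by rewrite !mxE eq_sym => /negbTE; rewrite /ty /= => ->; rewrite mulr0.
rewrite !mxE eqxx mulr1 addr0 /c; case: pickP => [[u' v'] /eqP|/(_ (u, v))].
  by move/esym/fi.
by rewrite eqxx.
Qed.

End Classes.

(** * The two families expressed through code indicators *)

Lemma match_insub2 (A T : Type) (P Q : pred T) (sP : subType P) (sQ : subType Q)
    (a b : T) (F : sP -> sQ -> A) (c z : A) :
    (forall (u : sP) (v : sQ), val u = a -> val v = b -> F u v = c) ->
  match insub a : option sP, insub b : option sQ with
  | Some u, Some v => F u v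
  | _, _ => z
  end = if P a && Q b then c else z.
Proof.
move=> Fc; case: insubP => [u Pa ua|/negbTE-> //]; rewrite Pa.
by case: insubP => [v Qb vb|/negbTE-> //]; rewrite Qb Fc.
Qed.

Section Families.
Variables (K : fieldType) (Omega : finType) (m : nat).
Variable x : ksub [set: Omega] m.
Local Open Scope ring_scope.
Local Notation vertex := (vertex Omega m).
Local Notation X := (Xmx K m (val x)).
Local Notation level := (level m).
Implicit Types u v w : vertex.

(** For the converse of [GammaP], [base_walk] supplies a walk of length [k]; a shorter one is
    excluded by [walk_base], which fixes the parity of the length and bounds its half from below. *)
Lemma Gamma_level k u : (k <= m.*2.+1)%N ->
  (u \in Gamma x k) = (pro (val x) (val u) == level k).
Proof.
move=> k2; have xm : #|val x| = m by case/andP: (valP x) => _ /eqP.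
apply/idP/eqP=> [/GammaP[c1 c2]|[c1 c2]]; first by rewrite /pro c1 -setDE c2.
have cu : #|val u| = (m + odd k)%N.
  by rewrite -(pro_card (val x)) /= c1 c2 (level_card k2).
have cd : #|val x :\: val u| = k./2 by rewrite cardsD xm setIC c1; lia.
rewrite inE; apply/andP; split.
  have := base_walk x u; rewrite cu cd -addn1 eqn_add2l eqb1.
  by rewrite addnC odd_double_half.
apply/forallP=> -[j jk] /=; apply/negP=> /walk_base[cu' cd'].
move: cu'; rewrite cu => /addnI; rewrite cd in cd'.
have := odd_double_half j; have := odd_double_half k.
by case: (odd k); case: (odd j) => //=; lia.
Qed.

Lemma vertex_level u :
  exists2 k, (k <= m.*2.+1)%N & pro (val x) (val u) = level k.
Proof.
have xm : #|val x| = m by case/andP: (valP x) => _ /eqP.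
have cx : (#|val x :&: val u| + #|val x :\: val u| = m)%N by rewrite cardsID.
have k2 : (#|val x :\: val u|.*2 + (#|val u| == m.+1) <= m.*2.+1)%N.
  by case: eqP => _; lia.
exists (#|val x :\: val u|.*2 + (#|val u| == m.+1))%N => //.
have c1 : #|val u :&: val x| = (m - #|val x :\: val u|)%N by rewrite setIC; lia.
have c2 : (m - #|val x :\: val u| + #|val u :&: ~: val x| = #|val u|)%N.
  by rewrite -c1 -setDE cardsID.
have Dm : (#|val x :\: val u| <= m)%N by lia.
rewrite /pro c1 /level; move: c2 Dm (valP u); rewrite {cx k2 c1}.
move: #|val u| #|val x :\: val u| #|val u :&: ~: val x| => c D b.
by case: (eqVneq c m.+1) => [->|_] e Dm cm; congr (_, _); lia.
Qed.

Lemma level_inj i j : (i <= m.*2.+1)%N -> (j <= m.*2.+1)%N ->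
  level i = level j -> i = j.
Proof. by move=> i2 j2 []; lia. Qed.

Lemma Estar_Emx k : (k <= m.*2.+1)%N -> Estar K x k = Emx K m (val x) (level k).
Proof.
move=> k2; apply/matrixP=> p q; rewrite !mxE (inj_eq enum_val_inj).
by rewrite Gamma_level.
Qed.

(** The generation argument uses [Emx] at all profiles, whereas the generators [Estar] only cover
    the levels. *)
Lemma Emx_level_or0 p :
  (exists2 k, (k <= m.*2.+1)%N & p = level k) \/ Emx K m (val x) p = 0.
Proof.
have [/existsP[u /eqP pu]|/existsPn np] :=
    boolP [exists u : vertex, pro (val x) (val u) == p].
  by left; have [k k2 e] := vertex_level u; exists k; rewrite // -pu.
by right; apply/matrixP=> i j; rewrite !mxE (negbTE (np _)) andbF.
Qed.

Lemma kron_rank i j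
    (P : 'M[K]_(#|ksub (val x) (m - i./2)|, #|ksub (val x) (m - j./2)|))
    (Q : 'M[K]_(#|ksub (~: val x) (uphalf i)|, #|ksub (~: val x) (uphalf j)|))
    (u : Gammat x i) (v : Gammat x j) :
  kron P Q (enum_rank u) (enum_rank v) =
  P (enum_rank (coord1 u)) (enum_rank (coord1 v)) *
  Q (enum_rank (coord2 u)) (enum_rank (coord2 v)).
Proof.
rewrite [LHS]mxE.
transitivity (tensmx P Q (kron_index u) (kron_index v)); last exact: tensmxE.
by congr (tensmx P Q (kron_index _) (kron_index _)); apply: enum_rankK.
Qed.

(** The traces of [u] and [v] on [x] meet in the trace of [u :&: v], and likewise outside [x], so
    entries of the block depend only on the profile of [u :&: v]. *)
Lemma Lmx_kron i j (h1 h2 : nat -> K)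
    (P : 'M[K]_(#|ksub (val x) (m - i./2)|, #|ksub (val x) (m - j./2)|))
    (Q : 'M[K]_(#|ksub (~: val x) (uphalf i)|, #|ksub (~: val x) (uphalf j)|)) :
    (forall y z, P (enum_rank y) (enum_rank z) = h1 #|val y :&: val z|) ->
    (forall y z, Q (enum_rank y) (enum_rank z) = h2 #|val y :&: val z|) ->
  Lmx (kron P Q) =
  mxfun (fun u v => ((u \in Gamma x i) && (v \in Gamma x j))%:R *
    (h1 (pro (val x) (val u :&: val v)).1 *
     h2 (pro (val x) (val u :&: val v)).2)).
Proof.
move=> PE QE; apply/matrixP=> p q; rewrite [LHS]mxE [RHS]mxE.
set rhs := (h1 _ * h2 _).
rewrite (match_insub2 (c := rhs) (P := mem (Gamma x i)) (Q := mem (Gamma x j))).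
  by case: andP => _; rewrite ?mul1r ?mul0r.
move=> u v uE vE; rewrite kron_rank PE QE /rhs /= -uE -vE.
by rewrite setIACA setIid !setDE setIACA setIid.
Qed.

Lemma Hmx_rank l i j (V : {set Omega}) (y : ksub V i) (z : ksub V j) :
  Hmx K l i j V (enum_rank y) (enum_rank z) = (#|val y :&: val z| == l)%:R.
Proof.
by rewrite mxE (enum_rankK y) (enum_rankK z).
Qed.

Lemma Cmx_rank l i j (V : {set Omega}) (y : ksub V i) (z : ksub V j) :
  Cmx K l i j V (enum_rank y) (enum_rank z) = 'C(#|val y :&: val z|, l)%:R.
Proof.
by rewrite mxE (enum_rankK y) (enum_rankK z).
Qed.

Definition Hblock i j g r : 'M[K]_#|vertex| :=
  Lmx (kron (Hmx K g (m - i./2) (m - j./2) (val x))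
            (Hmx K r (uphalf i) (uphalf j) (~: val x))).

Definition Cblock i j l t : 'M[K]_#|vertex| :=
  Lmx (kron (Cmx K l (m - i./2) (m - j./2) (val x))
            (Cmx K t (uphalf i) (uphalf j) (~: val x))).

Lemma Hblock_Xmx i j g r : (i <= m.*2.+1)%N -> (j <= m.*2.+1)%N ->
  Hblock i j g r = X (level i, level j, (g, r)).
Proof.
move=> i2 j2; rewrite /Hblock.
rewrite (Lmx_kron (h1 := fun c => (c == g)%:R) (h2 := fun c => (c == r)%:R)) //;
  try exact: Hmx_rank.
apply: eq_mxfun => u v; rewrite typE !Gamma_level // -!natrM !mulnb /=.
by rewrite -andbA [_ == (g, r)]xpair_eqE.
Qed.

Lemma Cblock_sum i j l t N : (i <= m.*2.+1)%N -> (j <= m.*2.+1)%N ->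
    (#|Omega| < N)%N ->
  Cblock i j l t = \sum_(o : 'I_N * 'I_N)
    ('C(o.1, l) * 'C(o.2, t))%:R *:
    X (level i, level j, (o.1 : nat, o.2 : nat)).
Proof.
move=> i2 j2 ltN; rewrite /Cblock.
rewrite (Lmx_kron (h1 := fun c => 'C(c, l)%:R) (h2 := fun c => 'C(c, t)%:R)) //;
  try exact: Cmx_rank.
apply/matrixP=> p q; rewrite summxE mxE.
set u := enum_val p; set v := enum_val q; rewrite !Gamma_level //.
have lt (A : {set Omega}) : (#|A| < N)%N.
  by apply: leq_ltn_trans ltN; apply: max_card.
(* The only index whose indicator can be nonzero at the entry [(p, q)]. *)
pose o0 := (Ordinal (lt (val u :&: val v :&: val x)),
            Ordinal (lt (val u :&: val v :&: ~: val x))).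
rewrite (bigD1 o0) //= big1 => [|[o1 o2] /negbTE no].
  by rewrite addr0 !mxE typE eqxx andbT -natrM mulrC.
rewrite !mxE typE.
suff -> : (pro (val x) (val u :&: val v) == (val o1, val o2)) = false.
  by rewrite !andbF mulr0.
apply: contraFF no => /eqP[e1 e2].
by rewrite /o0 xpair_eqE -!val_eqE /= e1 e2 !eqxx.
Qed.

(** One duplicate-free index list for both families, which makes them maps over the same list and
    hence of equal length. *)
Definition labels : seq ((nat * nat) * (nat * nat)) :=
  [seq (ij, gr) | ij <- [seq (i, j) | i <- iota 0 m.*2.+2, j <- iota 0 m.*2.+2],
     gr <- [seq (g, r) |
       g <- Hsupp K (m - ij.1./2) (m - ij.2./2) (val x),
       r <- Hsupp K (uphalf ij.1) (uphalf ij.2) (~: val x)]].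

Lemma family_GR_map (F : nat -> nat -> nat -> nat -> 'M[K]_#|vertex|) :
  family_GR x F = [seq F t.1.1 t.1.2 t.2.1 t.2.2 | t <- labels].
Proof.
rewrite /family_GR /labels map_allpairs /allpairs_dep; congr flatten.
rewrite -/(allpairs_dep _ _ _) map_allpairs; congr flatten.
apply: eq_map => i; apply: eq_map => j /=.
by rewrite map_allpairs.
Qed.

Lemma labels_uniq : uniq labels.
Proof.
have pairs_uniq (s1 s2 : seq nat) : uniq s1 -> uniq s2 ->
    uniq [seq (a, b) | a <- s1, b <- s2].
  by move=> u1 u2; apply: allpairs_uniq => // -[a b] [c d].
apply: allpairs_uniq_dep => [|ij _|].
- by apply: pairs_uniq; apply: iota_uniq.
- by apply: pairs_uniq; apply/filter_uniq/iota_uniq.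
- by move=> [a b] [c d] _ _ /= [-> ->].
Qed.

Lemma mem_labels i j g r : ((i, j), (g, r)) \in labels =
  [&& (i <= m.*2.+1)%N, (j <= m.*2.+1)%N,
      Hmx K g (m - i./2) (m - j./2) (val x) != 0
    & Hmx K r (uphalf i) (uphalf j) (~: val x) != 0].
Proof.
rewrite /labels; apply/allpairsPdep/and4P.
  case=> ij [gr [h1 h2 [e1 e2]]].
  move: h1 h2; rewrite -e1 -e2 => /allpairsP[[a b]].
  rewrite !mem_iota !add0n !ltnS => -[/= ha hb [ea eb]].
  case/allpairsP=> [[c d]]; rewrite !mem_Hsupp => -[/= hc hd [ec ed]].
  by move: ha hb hc hd; rewrite -ea -eb -ec -ed => ha hb hc hd; split.
case=> h1 h2 h3 h4; exists (i, j), (g, r); split=> //.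
  by apply: allpairs_f; rewrite mem_iota; lia.
by apply: allpairs_f; rewrite mem_Hsupp.
Qed.

(** Nonzero entries of the two [Hmx] factors provide the traces of [u] and [v] inside and outside
    [x]; gluing the traces gives the vertices. *)
Lemma labels_typ i j g r : ((i, j), (g, r)) \in labels ->
  exists u v, typ (val x) (val u) (val v) = (level i, level j, (g, r)).
Proof.
rewrite mem_labels => /and4P[i2 j2 /matrix0Pn[a [b]] + /matrix0Pn[c [d]]].
have nzb (b0 : bool) : b0%:R != 0 :> K -> b0 by case: b0; rewrite ?eqxx.
rewrite !mxE => /nzb/eqP g0 /nzb/eqP r0.
have glue k (y : ksub (val x) (m - k./2)) (z : ksub (~: val x) (uphalf k)) :
    (k <= m.*2.+1)%N -> exists2 u : vertex, val u = val y :|: val z &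
      (val u :&: val x = val y) /\ (val u :&: ~: val x = val z).
  move=> k2; have /andP[ys /eqP cy] := valP y; have /andP[zs /eqP cz] := valP z.
  have e1 : (val y :|: val z) :&: val x = val y.
    rewrite setIUl (setIidPl ys) (_ : val z :&: val x = set0) ?setU0 //.
    by apply/eqP; rewrite setI_eq0 disjoints_subset.
  have e2 : (val y :|: val z) :&: ~: val x = val z.
    rewrite setIUl (setIidPl zs) (_ : val y :&: ~: val x = set0) ?set0U //.
    by apply/eqP; rewrite setI_eq0 disjoints_subset setCK.
  have cyz : #|val y :|: val z| = (m + odd k)%N.
    by rewrite -(pro_card (val x)) /pro e1 e2 /= cy cz -(level_card k2).
  have P : (#|val y :|: val z| == m) || (#|val y :|: val z| == m.+1).
    by rewrite cyz; case: (odd k); rewrite ?addn0 ?addn1 eqxx ?orbT.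
  by exists (Sub (val y :|: val z) P).
have [u _ [u1 u2]] := glue i (enum_val a) (enum_val c) i2.
have [v _ [v1 v2]] := glue j (enum_val b) (enum_val d) j2.
exists u, v; rewrite /typ /pro.
have -> : val u :&: val v :&: val x =
    (val u :&: val x) :&: (val v :&: val x).
  by rewrite setIACA setIid.
have -> : val u :&: val v :&: ~: val x =
    (val u :&: ~: val x) :&: (val v :&: ~: val x).
  by rewrite setIACA setIid.
rewrite u1 u2 v1 v2 g0 r0.
have /andP[_ /eqP->] := valP (enum_val a).
have /andP[_ /eqP->] := valP (enum_val b).
have /andP[_ /eqP->] := valP (enum_val c).
by have /andP[_ /eqP->] := valP (enum_val d).
Qed.

Lemma Hfamily_map :
  Hfamily K x = [seq X (level t.1.1, level t.1.2, t.2) | t <- labels].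
Proof.
rewrite /Hfamily family_GR_map; apply/eq_in_map => -[[i j] [g r]].
by rewrite mem_labels => /and4P[i2 j2 _ _]; apply: Hblock_Xmx.
Qed.

(** Reading a vanishing combination at the entry that isolates one member shows that its coefficient
    is zero. *)
Lemma free_map_mx (I : eqType) a b (F : I -> 'M[K]_(a, b)) (s : seq I) :
    uniq s ->
    {in s, forall i, exists p q, {in s, forall j, F j p q = (j == i)%:R}} ->
  free (map F s).
Proof.
move=> us sep; apply/(@freeP _ _ _ (in_tuple (map F s))) => k /= sum0 i.
have ltF (j : 'I_(size (map F s))) : (j < size s)%N by rewrite -(size_map F).
case: s => [|i0 s] in us sep k sum0 i ltF *; first by case: i.
set s' := i0 :: s in us sep k sum0 i ltF *.
have [p [q pq]] := sep (nth i0 s' i) (mem_nth i0 (ltF i)).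
have := congr1 (fun M : 'M[K]_(a, b) => M p q) sum0.
rewrite summxE mxE (bigD1 i) //=.
have nthF (j : 'I_(size (map F s'))) :
    [seq F i | i <- s']`_j = F (nth i0 s' j).
  by rewrite (nth_map i0).
rewrite big1 => [|j ji]; rewrite mxE nthF pq ?mem_nth // nth_uniq //.
  by rewrite eqxx mulr1 addr0.
by rewrite val_eqE (negbTE ji) mulr0.
Qed.

End Families.

(** * Span arguments and the two bases of the Terwilliger algebra *)

Lemma span_ind (K : fieldType) (V : vectType K) (P : V -> Prop) (s : seq V) :
    P 0%R -> (forall a v w, P v -> P w -> P (a *: v + w)%R) ->
    {in s, forall v, P v} ->
  forall v, v \in <<s>>%VS -> P v.
Proof.
move=> P0 Plin Ps v /(@coord_span _ _ _ (in_tuple s)) ->.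
elim/big_rec: _ => // i w _ Pw; apply: Plin => //; apply: Ps.
by rewrite mem_nth.
Qed.

(** A dimension count: a family that spans at least as much as a free one of the same size is itself
    free. *)
Lemma free_span_size (K : fieldType) (V : vectType K) (s t : seq V) :
  free s -> (<<s>> <= <<t>>)%VS -> size t = size s ->
  free t /\ <<t>>%VS = <<s>>%VS.
Proof.
move=> /eqP fs st e; have ts : <<t>>%VS = <<s>>%VS.
  by apply/esym/eqP; rewrite eqEdim st fs -e dim_span.
by split=> //; rewrite /free ts fs e.
Qed.

Section Bases.
Variables (K : fieldType) (Omega : finType) (m : nat).
Variable x : ksub [set: Omega] m.
Local Open Scope ring_scope.
Local Notation vertex := (vertex Omega m).
Local Notation X := (Xmx K m (val x)).
Local Notation level := (level m).
Implicit Types u v w : vertex.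

(** Each label has its code attained at some pair, and [level_inj] makes the codes of distinct
    labels distinct, so that entry isolates one member. *)
Lemma free_Hfamily : free (Hfamily K x).
Proof.
rewrite Hfamily_map.
apply: free_map_mx; first exact: labels_uniq.
case=> [[i j] [g r]] tl; have [u [v uv]] := labels_typ tl.
exists (enum_rank u), (enum_rank v) => -[[i' j'] [g' r']] tl' /=.
rewrite mxE !enum_rankK uv eq_sym; congr (nat_of_bool _)%:R.
move: tl tl'; rewrite !mem_labels => /and4P[i2 j2 _ _] /and4P[i2' j2' _ _].
apply/eqP/eqP => [[e1 e2 e3 e4 -> ->]|[-> -> -> ->] //].
have -> : i' = i by apply: level_inj i2' i2 _; rewrite /level e1 e2.
by have -> : j' = j by apply: level_inj j2' j2 _; rewrite /level e3 e4.
Qed.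

Lemma Xmx_label t : X t != 0 ->
  exists2 l, l \in labels K x & t = (level l.1.1, level l.1.2, l.2).
Proof.
case/matrix0Pn=> p [q]; rewrite mxE; set u := enum_val p; set v := enum_val q.
case: (boolP (typ _ _ _ == t)) => [/eqP uv _|_]; last by rewrite eqxx.
have [i i2 ui] := vertex_level x u; have [j j2 vj] := vertex_level x v.
exists ((i, j), pro (val x) (val u :&: val v)); last by rewrite -uv /typ ui vj.
rewrite mem_labels i2 j2 /=.
have uG : u \in Gamma x i by rewrite Gamma_level // ui.
have vG : v \in Gamma x j by rewrite Gamma_level // vj.
pose u' : Gammat x i := Sub u uG; pose v' : Gammat x j := Sub v vG.
apply/andP; split; apply/matrix0Pn.
  exists (enum_rank (coord1 u')), (enum_rank (coord1 v')); rewrite Hmx_rank /=.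
  by rewrite setIACA setIid eqxx oner_eq0.
exists (enum_rank (coord2 u')), (enum_rank (coord2 v')); rewrite Hmx_rank /=.
by rewrite !setDE setIACA setIid eqxx oner_eq0.
Qed.

Lemma Xmx_Hfamily t : X t \in <<Hfamily K x>>%VS.
Proof.
case: (eqVneq (X t) 0) => [->|/Xmx_label[l ll tE]]; first exact: mem0v.
apply: memv_span; rewrite Hfamily_map tE.
by apply: (map_f (fun l => X (_, _, l.2))).
Qed.

(** Reduces membership in the span to invariance of the entries under equality of codes. *)
Lemma mem_Hfamily (M : 'M[K]_#|vertex|) : M \in <<Hfamily K x>>%VS <->
  typ_invariant (val x) (fun u v => M (enum_rank u) (enum_rank v)).
Proof.
split=> [|Mi]; last first.
  rewrite [M]mxfun_surj; apply: (typ_invariant_span Mi) => t.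
  exact: Xmx_Hfamily.
pose inv (N : 'M[K]_#|vertex|) :=
  typ_invariant (val x) (fun u v => N (enum_rank u) (enum_rank v)).
apply: (span_ind (P := inv)) => [||N]; first by move=> ? ? ? ? _; rewrite !mxE.
  move=> a N1 N2 N1i N2i u v u' v' e.
  have mxDZ p q : (a *: N1 + N2) p q = a * N1 p q + N2 p q by rewrite !mxE.
  by rewrite !mxDZ (N1i _ _ _ _ e) (N2i _ _ _ _ e).
rewrite Hfamily_map => /mapP[l _ ->] u v u' v' e.
by rewrite !mxE !enum_rankK e.
Qed.

Lemma Hfamily_subalgebra : is_subalgebra <<Hfamily K x>>%VS.
Proof.
split.
  apply/mem_Hfamily => u v u' v' e; rewrite !mxE !(inj_eq enum_rank_inj).
  by rewrite -[u == v]val_eqE -[u' == v']val_eqE (typ_eq e).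
move=> M N /mem_Hfamily Mi /mem_Hfamily Ni.
rewrite [M]mxfun_surj [N]mxfun_surj mxfun_mul.
apply: (typ_invariant_span (typ_invariant_mul Mi Ni)) => t.
exact: Xmx_Hfamily.
Qed.

Lemma Amx_Hfamily : Amx K Omega m \in <<Hfamily K x>>%VS.
Proof.
apply/mem_Hfamily => u v u' v' e; rewrite !mxE !enum_rankK /adj.
rewrite (typ_subset e) (typ_subset (typ_sym e)).
by case: e => a1 a2 b1 b2 _ _; rewrite -!(pro_card (val x)) /= a1 a2 b1 b2.
Qed.

Lemma Estar_Hfamily k : (k <= m.*2.+1)%N -> Estar K x k \in <<Hfamily K x>>%VS.
Proof. by move=> k2; rewrite Estar_Emx // Emx_Xmx Xmx_Hfamily. Qed.

Hypothesis natK_eq0 : forall n, ((n%:R : K) == 0)%R = (n == 0).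

(** The span is itself a subalgebra containing the generators, and [P_Xmx] places every member of
    the family in any other such subalgebra. *)
Lemma Terwilliger_Hfamily M : Terwilliger K x M <-> M \in <<Hfamily K x>>%VS.
Proof.
split=> [|MH S [S1 SM] SA SE].
  apply; first exact: Hfamily_subalgebra.
    exact: Amx_Hfamily.
  exact: Estar_Hfamily.
(* [S] need not be closed under transposition, so the transpose is carried along; the generators are
   symmetric. *)
pose P N := N \in S /\ N^T \in S.
suff /subvP : (<<Hfamily K x>> <= S)%VS by apply.
apply/span_subvP => N; rewrite Hfamily_map => /mapP[[[i j] [g r]] + ->].
rewrite mem_labels => /and4P[i2 j2 _ _] /=.
suff [] : P (X (level i, level j, (g, r))) by [].
apply: P_Xmx => //.
- move=> c N1 N2 [N1S N1T] [N2S N2T]; split; first by apply/memvD/N2S/memvZ.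
  by rewrite linearD linearZ /=; apply/memvD/N2T/memvZ.
- move=> N1 N2 [N1S N1T] [N2S N2T]; split; first exact: SM.
  by rewrite trmx_mul; apply: SM.
- by move=> N1 [N1S N1T]; split=> //; rewrite trmxK.
- by rewrite /P trmx0 mem0v.
- by rewrite /P Amx_tr.
move=> p; rewrite /P Emx_tr.
case: (Emx_level_or0 K x p) => [[k k2 ->]|->]; last by rewrite mem0v.
by rewrite -Estar_Emx // SE.
Qed.

Lemma Cfamily_map :
  Cfamily K x = [seq Cblock K x l.1.1 l.1.2 l.2.1 l.2.2 | l <- labels K x].
Proof. exact: family_GR_map. Qed.

(** Downward induction on [g + r]: the expansion of [Cblock] at [(g, r)] has leading term [X t] with
    coefficient 1, and its other nonzero terms have a larger index sum. *)
Lemma Xmx_Cfamily t : X t \in <<Cfamily K x>>%VS.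
Proof.
pose N := #|Omega|.+1.
have [k] : exists k, (N.*2 <= t.2.1 + t.2.2 + k)%N.
  by exists N.*2; apply: leq_addl.
elim: k t => [|k IH] t tk; case: (eqVneq (X t) 0) => [->|/Xmx_label[l ll tE]];
  try exact: mem0v.
all: case: l ll tE => [[i j] [g r]] /= ll tE; have [u [v []]] := labels_typ ll.
all: move=> _ _ _ _ gE rE.
all: have gN : (g < N)%N by rewrite -gE ltnS max_card.
all: have rN : (r < N)%N by rewrite -rE ltnS max_card.
  (* For [k = 0] the index sum would be at least [N.*2], impossible for an attained code as [g] and
     [r] are below [N]. *)
  by move: tk; rewrite tE /=; lia.
move: (ll); rewrite mem_labels => /and4P[i2 j2 _ _].
have := Cblock_sum K x g r i2 j2 (ltnSn #|Omega|).
rewrite (bigD1 (Ordinal gN, Ordinal rN)) //= !binn mul1n scale1r -tE.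
move/esym/(canRL (addrK _)) ->; apply: memvB.
  by apply: memv_span; rewrite Cfamily_map; apply/mapP; exists ((i, j), (g, r)).
apply: memv_suml => -[o1 o2] /= no.
(* Binomials vanish unless [o1] and [o2] are at least [g] and [r]; since the pair differs from
   [(g, r)], the sum then strictly increases. *)
case: (ltnP o1 g) => [lt|ge]; first by rewrite bin_small // mul0n scale0r mem0v.
case: (ltnP o2 r) => [lt|ge'].
  by rewrite (@bin_small o2) // muln0 scale0r mem0v.
apply/memvZ/IH; move: tk no ge ge'; rewrite tE xpair_eqE -!val_eqE /=.
by move: (N.*2) (nat_of_ord o1) (nat_of_ord o2) => M a b; lia.
Qed.

Lemma Cfamily_basis :
  free (Cfamily K x) /\ <<Cfamily K x>>%VS = <<Hfamily K x>>%VS.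
Proof.
apply: free_span_size; first exact: free_Hfamily.
  apply/span_subvP => M; rewrite Hfamily_map => /mapP[l _ ->].
  exact: Xmx_Cfamily.
by rewrite Cfamily_map Hfamily_map !size_map.
Qed.

End Bases.

Theorem theorem4p1 (R : realType) (n m : nat) (Omega : finType)
    (hOmega : #|Omega| = n) (hnm : 3 * m <= n) (x : ksub [set: Omega] m) :
  is_basis (Terwilliger R[i] x) (Hfamily R[i] x) /\
  is_basis (Terwilliger R[i] x) (Cfamily R[i] x).
Proof.
have char0 : forall k, (k%:R == 0 :> R[i])%R = (k == 0).
  by apply/pcharf0P; apply: Num.Theory.pchar_num.
have [freeC spanC] := Cfamily_basis R[i] x.
split; split; first exact: free_Hfamily.
- by move=> M; apply: Terwilliger_Hfamily.
- exact: freeC.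
by move=> M; rewrite spanC; apply: Terwilliger_Hfamily.
Qed.
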